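(* Up to isomorphism, the class of free hypergraph C*-algebras coincides with the class of C*-algebras of synchronous nonlocal games. Furthermore, it is enough to restrict to synchronous nonlocal games with only $|O| \le 3$ outputs: every free hypergraph C*-algebra is isomorphic to the C*-algebra of some synchronous nonlocal game with $|O|\le 3$.
   Context: All C*-algebras are unital (the zero algebra is allowed) and all $*$-homomorphisms are unital. A hypergraph $H$ consists of a finite set of vertices $V(H)$ and a collection of edges $E(H) \subseteq 2^{V(H)}$ (the empty edge is allowed) such that every vertex is contained in at least one edge. The free hypergraph C*-algebra $C^*(H)$ is the universal unital C*-algebra generated by elements $(p_v)_{v\in V(H)}$ subject to the relations $p_v = p_v^* = p_v^2$ for all $v \in V(H)$ and $\sum_{v\in e} p_v = 1$ for all $e\in E(H)$. A (two-player) nonlocal game is given by finite sets $I$ (inputs) and $O$ (outputs), the same for both players, and a map $\lambda : I \times I \times O \times O \to \{0,1\}$. It is synchronous if $\lambda(x,x,a,b) = \delta_{a,b}$ for every $x\in I$ and all $a,b\in O$. The C*-algebra of a synchronous nonlocal game is the universal unital C*-algebra generated by projections $\{p_{x,a} : x\in I,\ a\in O\}$ subject to the relations $\sum_{a\in O} p_{x,a} = 1$ for all $x\in I$, and $p_{x,a}\, p_{y,b} = 0$ whenever $\lambda(x,y,a,b) = 0$. *)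

(* Defs.v *)
From HB Require Import structures.
From mathcomp Require Import all_boot all_order all_algebra.
From mathcomp Require Import complex.
From mathcomp Require Import boolp classical_sets reals topology normedtype.

Set Implicit Arguments.
Unset Strict Implicit.
Unset Printing Implicit Defensive.

Import Order.TTheory GRing.Theory Num.Theory.
Local Open Scope ring_scope.
Local Open Scope complex_scope.

(* Unital C*-algebras over the field R[i] of complex numbers.  The zero algebra
   (1 = 0) is allowed, which rules out MathComp's [algType], built on
   [nzRingType]; and Hierarchy-Builder cannot join [pzRingType] with normed
   modules, because [numDomainType] already inherits from both.  So product and
   unit are fields of the mixin, and the [pzRingType] structure is derived
   below.  The norm of a normed module over R[i] is R[i]-valued, with values in
   the nonnegative reals. *)
HB.mixin Record CompleteNormedModule_isCStarAlgebra (R : realType) A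
    of CompleteNormedModule R[i] A := {
  cstar_one : A ;
  cstar_mul : A -> A -> A ;
  star : A -> A ;
  cstar_mulA : associative cstar_mul ;
  cstar_mul1l : left_id cstar_one cstar_mul ;
  cstar_mul1r : right_id cstar_one cstar_mul ;
  cstar_mulDl : left_distributive cstar_mul +%R ;
  cstar_mulDr : right_distributive cstar_mul +%R ;
  cstar_scaleAl : forall (c : R[i]) (x y : A),
    c *: cstar_mul x y = cstar_mul (c *: x) y ;
  cstar_scaleAr : forall (c : R[i]) (x y : A),
    c *: cstar_mul x y = cstar_mul x (c *: y) ;
  cstar_normM : forall x y : A, `|cstar_mul x y| <= `|x| * `|y| ;
  starK : involutive star ;
  starD : {morph star : x y / x + y} ;
  starZ : forall (c : R[i]) (x : A), star (c *: x) = c^* *: star x ;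
  starM : forall x y : A, star (cstar_mul x y) = cstar_mul (star y) (star x) ;
  cstar_identity : forall x : A, `|cstar_mul (star x) x| = `|x| ^+ 2
}.

#[short(type="cstarAlgType")]
HB.structure Definition CStarAlgebra (R : realType) :=
  {A of CompleteNormedModule R[i] A & CompleteNormedModule_isCStarAlgebra R A}.

HB.instance Definition _ (R : realType) (A : cstarAlgType R) :=
  GRing.Zmodule_isPzRing.Build (CStarAlgebra.sort A)
    (@cstar_mulA R A) (@cstar_mul1l R A) (@cstar_mul1r R A)
    (@cstar_mulDl R A) (@cstar_mulDr R A).

Section RingForm.
Variables (R : realType) (A : cstarAlgType R).
Implicit Types (c : R[i]) (x y : A).

Lemma cstar_scalerAl c x y : c *: (x * y) = (c *: x) * y.
Proof. exact: cstar_scaleAl. Qed.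

Lemma cstar_scalerAr c x y : c *: (x * y) = x * (c *: y).
Proof. exact: cstar_scaleAr. Qed.

Lemma cstar_ler_normM x y : `|x * y| <= `|x| * `|y|.
Proof. exact: cstar_normM. Qed.

Lemma starrM x y : star (x * y) = star y * star x.
Proof. exact: starM. Qed.

Lemma cstar_normr_identity x : `|star x * x| = `|x| ^+ 2.
Proof. exact: cstar_identity. Qed.

End RingForm.

Definition is_star_hom (R : realType) (A B : cstarAlgType R) (f : A -> B) : Prop :=
  [/\ linear f, f 1 = 1, {morph f : x y / x * y}
    & {morph f : x / star x}].

Definition cstar_isomorphic (R : realType) (A B : cstarAlgType R) : Prop :=
  exists2 f : A -> B, is_star_hom f & bijective f.

Definition is_projection (R : realType) (A : cstarAlgType R) (p : A) : Prop :=
  star p = p /\ p * p = p.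

(* [is_universal_cstar rel p]: the C*-algebra A with the family p is the
   universal unital C*-algebra generated by a family indexed by X subject to
   the relations [rel]. *)
Definition is_universal_cstar (R : realType) (X : Type)
    (rel : forall B : cstarAlgType R, (X -> B) -> Prop)
    (A : cstarAlgType R) (p : X -> A) : Prop :=
  rel A p /\
  forall (B : cstarAlgType R) (q : X -> B), rel B q ->
    exists! f : A -> B, is_star_hom f /\ forall x, f (p x) = q x.

Record hypergraph := Hypergraph {
  vertex : finType ;
  edges : {set {set vertex}} ;
  vertex_covered : forall v : vertex, exists2 e, e \in edges & v \in e
}.

Definition hypergraph_relations (R : realType) (H : hypergraph)
    (A : cstarAlgType R) (p : vertex H -> A) : Prop :=
  (forall v, is_projection (p v)) /\
  (forall e : {set vertex H}, e \in edges H -> \sum_(v in e) p v = 1).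

Definition is_hypergraph_algebra (R : realType) (H : hypergraph)
    (A : cstarAlgType R) : Prop :=
  exists p : vertex H -> A, is_universal_cstar (@hypergraph_relations R H) p.

Record nonlocal_game := NonlocalGame {
  input : finType ;
  output : finType ;
  rule : input -> input -> output -> output -> bool
}.

Definition synchronous (G : nonlocal_game) : Prop :=
  forall (x : input G) (a b : output G), rule x x a b = (a == b).

Definition game_relations (R : realType) (G : nonlocal_game)
    (A : cstarAlgType R) (p : input G * output G -> A) : Prop :=
  [/\ forall x a, is_projection (p (x, a)),
      forall x, \sum_(a : output G) p (x, a) = 1
    & forall x y a b, rule x y a b = false -> p (x, a) * p (y, b) = 0].

Definition is_game_algebra (R : realType) (G : nonlocal_game)
    (A : cstarAlgType R) : Prop :=
  exists p : input G * output G -> A,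
    is_universal_cstar (@game_relations R G) p.

(* Main.v *)
(* The main point is that projections of a C*-algebra with sum 1 are pairwise
   orthogonal.  If p is one of them and q runs over the others, the elements
   p - 2pqp = p(1 - 2q)p are contractions of the corner at p with average p, so
   it suffices that the unit p is an extreme point of the unit ball of its corner.
   The latter needs no spectral theory: from |p - a| <= 1 and |mp + a| <= m an
   induction on n yields 2k|cp + na| <= c^2 + nm + k^2 for all integers c, and
   taking c = 0, n = k^2 and k large forces a = 0.

   Given a hypergraph, the three outputs of an input of the game are the classes
   of a 3-colouring of an edge, output a standing for the sum of the p_v over its
   class, and two outputs are forbidden when every vertex of one class is distinct
   from and shares an edge with every vertex of the other.  The game relations
   make outputs with the same class equal, hence additive in the class, hence
   sums of values at single vertices.  Conversely, p and q are orthogonal iff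
   1 - p - q is a projection, so each forbidden pair of a game becomes an edge
   with one extra vertex.  In both cases the passage between families is natural
   and invertible, so it transports the universal property on the same algebra. *)
Require Import Defs.
From mathcomp Require Import all_boot all_order all_algebra.
From mathcomp Require Import complex ring.
From mathcomp Require Import boolp classical_sets reals topology normedtype.
From mathcomp Require Import finset.

Set Implicit Arguments.
Unset Strict Implicit.
Unset Printing Implicit Defensive.

Import Order.TTheory GRing.Theory Num.Theory.
Local Open Scope ring_scope.
Local Open Scope complex_scope.

(** * Orthogonality of projections with sum 1 *)

Section Projections.
Variables (R : realType) (A : cstarAlgType R).
Implicit Types p q a : A.

Lemma star1 : star (1 : A) = 1.
Proof. by rewrite -[LHS]mulr1 -{2}(starK 1) -starrM mulr1 starK. Qed.

Lemma is_projection1 : is_projection (1 : A).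
Proof. by split; [exact: star1 | rewrite mulr1]. Qed.

Lemma star0 : star (0 : A) = 0.
Proof. by apply: (addrI (star 0)); rewrite -starD !addr0. Qed.

Lemma starN (x : A) : star (- x) = - star x.
Proof. by apply: (addrI (star x)); rewrite -starD !subrr star0. Qed.

Lemma projection_norm_le1 p : is_projection p -> `|p| <= 1.
Proof.
move=> [sp pp]; have := cstar_normr_identity p; rewrite sp pp.
have [->|p0] := eqVneq `|p| 0; first by rewrite ler01.
by rewrite expr2 -{1}[`|p|]mulr1 => /(mulfI p0) <-.
Qed.

(** The element [1 - q *+ 2] is self-adjoint with square 1, so the C*-identity bounds its norm. *)
Lemma projection_reflection_norm_le1 q : is_projection q -> `|1 - q *+ 2| <= 1.
Proof.
move=> [sq qq]; rewrite -(@expr_le1 _ 2) // -cstar_normr_identity.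
have -> : star (1 - q *+ 2) = 1 - q *+ 2.
  by rewrite mulr2n starD starN starD sq star1.
rewrite mulrBl mul1r mulrBr mulr1 mulrnAl mulrnAr qq [_ *+ 2 *+ 2]mulr2n.
rewrite opprB addrK subrK.
exact/projection_norm_le1/is_projection1.
Qed.

Lemma star_mul_eq0 a : star a * a = 0 -> a = 0.
Proof.
move=> aa; apply/eqP; rewrite -normr_eq0 -sqrf_eq0.
by rewrite -cstar_normr_identity aa normr0.
Qed.

Lemma complex_ge0_bounded_eq0 (x : R[i]) (m : nat) :
  0 <= x -> (forall k : nat, x *+ k <= m%:R) -> x = 0.
Proof.
move=> x0 xm.
have xE : x = (complex.Re x)%:C by rewrite RRe_real ?ger0_real.
have Rx0 : 0 <= complex.Re x by move: x0; rewrite xE lecR.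
have [Re0|Rx] := eqVneq (complex.Re x) 0; first by rewrite xE Re0.
have Rxp : 0 < complex.Re x by rewrite lt_neqAle eq_sym Rx.
have := xm (Num.bound (m%:R / complex.Re x)).
rewrite xE -(rmorphMn (real_complex R)) /= -(rmorph_nat (real_complex R)) lecR.
rewrite leNgt -[complex.Re x *+ _]mulr_natl -ltr_pdivrMr // => /negP[].
by apply: archi_boundP; rewrite divr_ge0.
Qed.

(* One step of a random walk on the integer [c] which jumps by [- m] with weight
   1 and by [+ 1] with weight m: it has mean 0 and variance m, so that
   [c ^+ 2 + n * m] is preserved on average, while the terms in [a * a] cancel. *)
Lemma walk_bound p a (m k n : nat) (c : int) :
  p * p = p -> p * a = a -> a * p = a ->
  `|p| <= 1 -> `|p - a| <= 1 -> `|p *+ m + a| <= m%:R ->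
  `|p *~ c + a *+ n| *+ (2 * k) <= (c ^+ 2 + (n * m)%:Z + (k ^ 2)%:Z)%:~R.
Proof.
move=> pp pa ap p1 x1 y1; elim: n c => [|n IH] c.
  rewrite mulr0n addr0 mul0n addr0 -scaler_int normrZ.
  rewrite -mulr_natr.
  apply: (@le_trans _ _ (`|c%:~R| * (2 * k)%:R)).
    by rewrite ler_wpM2r // ler_piMr.
  rewrite -intr_norm -[(2 * k)%:R]/((2 * k)%N%:Z%:~R) -intrM ler_int.
  have -> : c ^+ 2 = `|c| ^+ 2 by rewrite real_normK ?num_real.
  rewrite PoszM -subr_ge0.
  (* The base case is [2k|c| <= c^2 + k^2]. *)
  have -> : `|c| ^+ 2 + (k ^ 2)%N%:Z - `|c| * (2%N%:Z * k%:Z) =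
      (`|c| - k%:Z) ^+ 2.
    by rewrite -[(k ^ 2)%N%:Z]/(Posz (k * k)) PoszM; ring.
  by rewrite sqr_ge0.
have step : (p *~ c + a *+ n.+1) *+ m.+1 =
    (p - a) * (p *~ (c - m%:Z) + a *+ n) +
    (p *+ m + a) * (p *~ (c + 1) + a *+ n).
  have -> : (p - a) * (p *~ (c - m%:Z) + a *+ n) =
      p *~ (c - m%:Z) + a *~ (n%:Z - (c - m%:Z)) - (a * a) *+ n.
    rewrite mulrDr mulrzAr mulrnAr !mulrBl pp pa ap.
    rewrite mulrzBl mulrnBl [a *~ _]mulrzBr !pmulrn !addrA.
    by congr (_ - _); rewrite addrAC.
  have -> : (p *+ m + a) * (p *~ (c + 1) + a *+ n) =
      p *~ (m%:Z * (c + 1)) + a *~ (n%:Z * m%:Z + (c + 1)) + (a * a) *+ n.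
    rewrite mulrDr mulrzAr mulrnAr !mulrDl !mulrnAl pp pa ap.
    rewrite [(_ + a) *~ _]mulrzDl mulrnDl [a *~ (_ * _ + _)]mulrzDr !pmulrn.
    rewrite !mulrzA.
    by rewrite -!addrA; congr (_ + _); rewrite [RHS]addrCA [a *~ n *~ m]mulrzAC.
  rewrite [_ + (a * a) *+ n]addrC addrA subrK addrACA -!mulrzDr !pmulrn.
  rewrite mulrzDl -!mulrzA.
  by congr (_ *~ _ + _ *~ _); rewrite !intS; ring.
rewrite -(@ler_pMn2r _ m.+1) // -mulrnAC -normrMn step.
apply: le_trans (_ : (`|p *~ (c - m%:Z) + a *+ n| +
    m%:R * `|p *~ (c + 1) + a *+ n|) *+ (2 * k) <= _).
  rewrite lerMn2r; apply/orP; right.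
  apply: le_trans (ler_normD _ _) _; apply: lerD.
    by apply: le_trans (cstar_ler_normM _ _) _; rewrite ler_piMl.
  by apply: le_trans (cstar_ler_normM _ _) _; rewrite ler_wpM2r.
rewrite mulrnDl -mulrnAr.
apply: le_trans (lerD (IH _) (ler_wpM2l _ (IH _))) _ => //.
rewrite -[m%:R]/(m%:Z%:~R) -intrM -intrD pmulrn -mulrzA.
rewrite ler_int mulSn !PoszD !PoszM intS le_eqVlt; apply/orP; left; apply/eqP.
ring.
Qed.

Lemma balanced_contraction_eq0 p a (m : nat) :
  p * p = p -> p * a = a -> a * p = a ->
  `|p| <= 1 -> `|p - a| <= 1 -> `|p *+ m + a| <= m%:R -> a = 0.
Proof.
move=> pp pa ap p1 x1 y1; apply/eqP; rewrite -normr_eq0; apply/eqP.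
apply: (@complex_ge0_bounded_eq0 _ m.+1) => // -[|k]; first by rewrite mulr0n.
(* With K = k + 1 the bound reads 2K K^2 |a| <= K^2 (m + 1); dividing by K^2 leaves 2K |a| <= m + 1
   for all K. *)
have := walk_bound k.+1 (k.+1 ^ 2) 0 pp pa ap p1 x1 y1.
rewrite mulr0z add0r expr0n add0r normrMn -PoszD -mulnSr mulnC -mulrnA.
rewrite -[_%:~R]/((_ * _)%:R) !(mulnC (k.+1 ^ 2)%N) !mulrnA.
rewrite !ler_pMn2r //; apply: le_trans.
by rewrite mulr2n lerDl mulrn_wge0.
Qed.

Lemma projection_sum_orthogonal (V : finType) (e : {set V}) (p : V -> A) u v :
  (forall w, is_projection (p w)) -> \sum_(w in e) p w = 1 ->
  u \in e -> v \in e -> u != v -> p u * p v = 0.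
Proof.
move=> proj_p sum_p ue ve uv.
have [spu ppu] := proj_p u; have [spv ppv] := proj_p v.
pose a w := (p v * p w * p v) *+ 2.
have corner w : p v - a w = p v * (1 - p w *+ 2) * p v.
  by rewrite mulrBr mulr1 mulrBl ppv mulrnAr mulrnAl.
have corner_le1 w : `|p v - a w| <= 1.
  rewrite corner (le_trans (cstar_ler_normM _ _)) // mulr_ile1 //.
    rewrite (le_trans (cstar_ler_normM _ _)) // mulr_ile1 //.
      exact: projection_norm_le1.
    exact: projection_reflection_norm_le1.
  exact: projection_norm_le1.
have sum_a : \sum_(w in e :\ v) a w = 0.
  have : p v * (\sum_(w in e) p w) * p v = p v by rewrite sum_p mulr1 ppv.
  rewrite (big_setD1 v) //= mulrDr ppv mulrDl ppv -[RHS]addr0 => /addrI.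
  rewrite mulr_sumr mulr_suml /a sumrMnl => ->.
  by rewrite mul0rn.
have uev : u \in e :\ v by rewrite !inE uv.
have au0 : a u = 0.
  apply: (@balanced_contraction_eq0 (p v) (a u) #|e :\ v :\ u|) => //.
  - by rewrite /a mulrnAr !mulrA ppv.
  - by rewrite /a mulrnAl -!mulrA ppv.
  - exact: projection_norm_le1.
  (* As the [a w] sum to 0, [a u] is minus the sum of the others, which leaves a sum of m
     contractions. *)
  have -> : p v *+ #|e :\ v :\ u| + a u = \sum_(w in e :\ v :\ u) (p v - a w).
    rewrite big_split /= sumr_const; congr (_ + _).
    move: sum_a; rewrite (big_setD1 u) //= sumrN => /eqP.
    by rewrite addr_eq0 => /eqP.
  rewrite (le_trans (ler_norm_sum _ _ _)) // -sumr_const.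
  by rewrite ler_sum.
(* For x = p u * p v, the product [star x * x] is p v * p u * p v, half of [a u]. *)
apply: star_mul_eq0; rewrite starrM spu spv mulrA -(mulrA (p v)) ppu.
apply/eqP; rewrite -normr_eq0; move/(congr1 Num.norm)/eqP: au0.
by rewrite /a normrMn normr0 mulrn_eq0.
Qed.

End Projections.

(** * Homomorphisms and transfer of universal properties *)

Section StarHom.
Variables (R : realType) (A B : cstarAlgType R) (f : A -> B).
Hypothesis hom_f : is_star_hom f.

Lemma star_homD : {morph f : x y / x + y}.
Proof.
by case: hom_f => lin_f _ _ _ x y; have := lin_f 1 x y; rewrite !scale1r.
Qed.

Lemma star_hom0 : f 0 = 0.
Proof. by apply: (addrI (f 0)); rewrite -star_homD !addr0. Qed.

Lemma star_homB : {morph f : x y / x - y}.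
Proof. by move=> x y; apply: (addIr (f y)); rewrite -star_homD !subrK. Qed.

Lemma star_hom_sum (I : Type) (r : seq I) (P : pred I) (F : I -> A) :
  f (\sum_(i <- r | P i) F i) = \sum_(i <- r | P i) f (F i).
Proof. exact: (big_morph f star_homD star_hom0). Qed.

End StarHom.

Lemma cstar_isomorphic_refl (R : realType) (A : cstarAlgType R) :
  cstar_isomorphic A A.
Proof. by exists id; [split | exists id]. Qed.

(** By naturality and invertibility, a homomorphism sends p to [G B q] exactly when it sends [F A p]
    to q, so existence and uniqueness carry over. *)
Lemma universal_cstar_transfer (R : realType) (X Y : Type)
    (rel1 : forall B : cstarAlgType R, (X -> B) -> Prop)
    (rel2 : forall B : cstarAlgType R, (Y -> B) -> Prop)
    (F : forall B : cstarAlgType R, (X -> B) -> Y -> B)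
    (G : forall B : cstarAlgType R, (Y -> B) -> X -> B) :
  (forall B p, rel1 B p -> rel2 B (F B p)) ->
  (forall B q, rel2 B q -> rel1 B (G B q)) ->
  (forall B p, rel1 B p -> G B (F B p) = p) ->
  (forall B q, rel2 B q -> F B (G B q) = q) ->
  (forall (B C : cstarAlgType R) (f : B -> C) p y,
     is_star_hom f -> f (F B p y) = F C (f \o p) y) ->
  (forall (B C : cstarAlgType R) (f : B -> C) q x,
     is_star_hom f -> f (G B q x) = G C (f \o q) x) ->
  forall (A : cstarAlgType R) (p : X -> A),
    is_universal_cstar rel1 p -> is_universal_cstar rel2 (F A p).
Proof.
move=> relF relG FK GK natF natG A p [rel_p univ_p]; split; first exact: relF.
move=> B q rel_q; have [f [[hom_f fp] f_uniq]] := univ_p B _ (relG B q rel_q).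
exists f; split=> [|g [hom_g gq]].
  split=> // y; rewrite natF // -[in RHS](GK B q rel_q).
  by congr (F B _ y); apply/funext => x /=; rewrite fp.
apply: f_uniq; split=> // x; rewrite -[in LHS](FK A p rel_p) natG //.
by congr (G B _ x); apply/funext => y /=; rewrite gq.
Qed.

Lemma projection_sum (R : realType) (A : cstarAlgType R) (V : finType)
    (S : {set V}) (p : V -> A) :
  (forall v, is_projection (p v)) ->
  {in S &, forall u v, u != v -> p u * p v = 0} ->
  is_projection (\sum_(v in S) p v).
Proof.
move=> proj_p orth_p; split.
  rewrite (big_morph _ (@starD R A) (star0 A)).
  by apply: eq_bigr => v _; case: (proj_p v).
rewrite mulr_suml; apply: eq_bigr => u uS; rewrite mulr_sumr (big_setD1 u) //=.
rewrite big1 ?addr0; first by case: (proj_p u).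
by move=> v; rewrite !inE => /andP[vu vS]; rewrite orth_p // eq_sym.
Qed.

Lemma projection_compl (R : realType) (A : cstarAlgType R) (p : A) :
  is_projection p -> is_projection (1 - p).
Proof.
move=> [sp pp]; split; first by rewrite starD starN star1 sp.
by rewrite mulrBl mul1r mulrBr mulr1 pp subrr subr0.
Qed.

(** * From hypergraphs to games with three outputs *)

Section GameOfHypergraph.
Variable H : hypergraph.
Notation V := (vertex H).

Definition hedge := {e : {set V} | e \in edges H}.

(* An input splits an edge into three (possibly empty) colour classes.  The
   boolean duplicates every input, because the synchronous rule cannot make an
   output with empty class vanish unless another input does. *)
Definition colour_input : finType := (hedge * {ffun V -> 'I_3} * bool)%type.

Definition colour_class (x : colour_input) (a : 'I_3) : {set V} :=
  [set v in val x.1.1 | x.1.2 v == a].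

Definition exclusive (u v : V) : bool :=
  (u != v) && [exists e in edges H, (u \in e) && (v \in e)].

(** Vacuous for an empty set: an output with empty class is thus forbidden with every output of any
    other input, which forces it to vanish. *)
Definition exclusive_sets (S T : {set V}) : bool :=
  [forall u in S, forall v in T, exclusive u v].

Definition colour_rule (x y : colour_input) (a b : 'I_3) : bool :=
  if x == y then a == b
  else ~~ exclusive_sets (colour_class x a) (colour_class y b).

Definition colour_game : nonlocal_game := NonlocalGame colour_rule.

Lemma colour_game_synchronous : synchronous colour_game.
Proof. by move=> x a b; rewrite /= /colour_rule eqxx. Qed.

Lemma exclusive_setsP (S T : {set V}) :
  reflect (forall u v, u \in S -> v \in T -> exclusive u v) (exclusive_sets S T).
Proof.
apply: (iffP forall_inP) => [h u v uS vT|h u uS].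
  by have /forall_inP := h u uS; apply.
by apply/forall_inP => v; apply: h.
Qed.

Lemma exclusive_in (e : hedge) u v :
  u \in val e -> v \in val e -> u != v -> exclusive u v.
Proof.
move=> ue ve uv; rewrite /exclusive uv; apply/existsP; exists (val e).
by rewrite ue ve (valP e).
Qed.

Variable R : realType.

Definition colour_family (A : cstarAlgType R) (p : V -> A)
    (i : colour_input * 'I_3) : A :=
  \sum_(v in colour_class i.1 i.2) p v.

Section HypergraphRepresentation.
Variables (A : cstarAlgType R) (p : V -> A).
Hypothesis rel_p : @hypergraph_relations R H A p.

Lemma exclusive_orthogonal u v : exclusive u v -> p u * p v = 0.
Proof.
case: rel_p => proj_p sum_p /andP[uv /existsP[e /and3P[eH ue ve]]].
exact: (projection_sum_orthogonal proj_p (sum_p e eH)).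
Qed.

Lemma colour_family_orthogonal x y a b :
  exclusive_sets (colour_class x a) (colour_class y b) ->
  colour_family p (x, a) * colour_family p (y, b) = 0.
Proof.
move=> /exclusive_setsP excl; rewrite /colour_family mulr_suml big1 // => u ux.
by rewrite mulr_sumr big1 // => v vy; rewrite exclusive_orthogonal ?excl.
Qed.

Lemma colour_family_relations :
  @game_relations R colour_game A (colour_family p).
Proof.
case: (rel_p) => proj_p sum_p; split.
- move=> x a; apply: projection_sum => // u v; rewrite !inE.
  move=> /andP[ux _] /andP[vx _] uv.
  exact: exclusive_orthogonal (exclusive_in ux vx uv).
- move=> x; rewrite -(sum_p _ (valP x.1.1)) [RHS](partition_big x.1.2 predT) //=.
  apply: eq_bigr => a _; rewrite /colour_family.
  by apply: eq_bigl => v; rewrite inE.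
move=> x y a b /=; rewrite /colour_rule; case: eqVneq => [<-|_] ab.
  apply: colour_family_orthogonal; apply/exclusive_setsP => u v; rewrite !inE.
  move=> /andP[ux /eqP ua] /andP[vx /eqP vb]; apply: exclusive_in ux vx _.
  by apply: contraFneq ab => uv; rewrite -ua -vb uv.
by apply: colour_family_orthogonal; move/negbFE: ab.
Qed.

End HypergraphRepresentation.

Definition indicator_colouring (S : {set V}) : {ffun V -> 'I_3} :=
  [ffun v => if v \in S then 1 else 0].

(** Copy [true] is the reference; copy [false] is kept for comparison with it. *)
Definition edge_input (e : hedge) (S : {set V}) : colour_input :=
  (e, indicator_colouring S, true).

Definition some_edge (v : V) : hedge :=
  let: exist2 e eH _ := cid2 (vertex_covered v) in exist _ e eH.

Lemma some_edgeP v : v \in val (some_edge v).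
Proof. by rewrite /some_edge; case: cid2. Qed.

(** The chosen edge is immaterial for a representation of the game, by [set_value1]. *)
Definition vertex_family (A : cstarAlgType R) (q : colour_input * 'I_3 -> A)
    (v : V) : A :=
  q (edge_input (some_edge v) [set v], 1).

Lemma edge_input_class1 e S : colour_class (edge_input e S) 1 = val e :&: S.
Proof.
by apply/setP => v; rewrite !inE /= ffunE; case: (v \in S); rewrite ?andbT ?andbF.
Qed.

Lemma colour_familyK (A : cstarAlgType R) (p : V -> A) :
  vertex_family (colour_family p) = p.
Proof.
apply/funext => v; rewrite /vertex_family /colour_family edge_input_class1.
by rewrite (setIidPr _) ?big_set1 // sub1set some_edgeP.
Qed.

Section GameRepresentation.
Variables (A : cstarAlgType R) (q : colour_input * 'I_3 -> A).
Hypothesis rel_q : @game_relations R colour_game A q.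

Lemma sum_outputs x : \sum_a q (x, a) = 1.
Proof. by case: rel_q. Qed.

Lemma game_family_orthogonal x y a b : x != y ->
  exclusive_sets (colour_class x a) (colour_class y b) ->
  q (x, a) * q (y, b) = 0.
Proof.
case: rel_q => _ _ orth xy excl; apply: orth.
by rewrite /= /colour_rule (negPf xy) excl.
Qed.

(** Both sides equal [q (x, a) * q (y, b)]: expand 1 over the outputs of the other input and only
    one term survives. *)
Lemma eq_game_family x y a b : x != y ->
  (forall b', b' != b -> exclusive_sets (colour_class x a) (colour_class y b')) ->
  (forall a', a' != a -> exclusive_sets (colour_class x a') (colour_class y b)) ->
  q (x, a) = q (y, b).
Proof.
move=> xy exclb excla.
have -> : q (x, a) = q (x, a) * q (y, b).
  rewrite -[LHS]mulr1 -(sum_outputs y) mulr_sumr (bigD1 b) //= big1 ?addr0 //.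
  by move=> b' b'b; rewrite game_family_orthogonal ?exclb.
rewrite -[RHS]mul1r -(sum_outputs x) mulr_suml (bigD1 a) //= big1 ?addr0 //.
by move=> a' a'a; rewrite game_family_orthogonal ?excla.
Qed.

Lemma game_family_same_class (e : hedge) c c' t t' a b :
  (e, c, t) != (e, c', t') :> colour_input ->
  colour_class (e, c, t) a = colour_class (e, c', t') b ->
  q (e, c, t, a) = q (e, c', t', b).
Proof.
move=> neq eqS; apply: eq_game_family => // [b' b'b|a' a'a].
  rewrite eqS; apply/exclusive_setsP => u v; rewrite !inE /=.
  move=> /andP[ue /eqP ub] /andP[ve /eqP vb]; apply: exclusive_in ue ve _.
  by apply: contra_neq b'b => uv; rewrite -ub -vb uv.
rewrite -eqS; apply/exclusive_setsP => u v; rewrite !inE /=.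
move=> /andP[ue /eqP ua] /andP[ve /eqP va]; apply: exclusive_in ue ve _.
by apply: contra_neq a'a => uv; rewrite -ua -va uv.
Qed.

(** For fixed e this turns out to be a finitely additive projection-valued measure, concentrated on
    e. *)
Definition set_value (e : hedge) (S : {set V}) : A := q (edge_input e S, 1).

Lemma game_familyE (x : colour_input) a :
  q (x, a) = set_value x.1.1 (x.1.2 @^-1: [set a]).
Proof.
case: x => [[e c] t] /=; pose S := c @^-1: [set a].
have eqS t' : colour_class (e, c, t') a = colour_class (edge_input e S) 1.
  by rewrite edge_input_class1; apply/setP => v; rewrite !inE.
(* Only distinct inputs can be compared, and [(e, c, true)] may be the reference input itself; copy
   [false] never is, so it serves as intermediary. *)
have tf : q (e, c, false, a) = set_value e S.
  by apply: game_family_same_class (eqS _); rewrite xpair_eqE andbF.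
case: t => //; rewrite -tf; apply: game_family_same_class => //.
by rewrite xpair_eqE andbF.
Qed.

Lemma set_value_eq0 e S : val e :&: S = set0 -> set_value e S = 0.
Proof.
move=> eS0; pose x : colour_input := (e, indicator_colouring S, false).
rewrite -[LHS]mulr1 -(sum_outputs x) mulr_sumr big1 // => b _.
apply: game_family_orthogonal; first by rewrite xpair_eqE andbF.
by apply/exclusive_setsP => u v; rewrite edge_input_class1 eS0 inE.
Qed.

Lemma set_value0 e : set_value e set0 = 0.
Proof. by rewrite set_value_eq0 // setI0. Qed.

Lemma set_value_tripartition e (S T : {set V}) : [disjoint S & T] ->
  set_value e S + set_value e T + set_value e (~: (S :|: T)) = 1.
Proof.
(* Two disjoint sets and the rest take three colours: this is where three outputs are used. *)
move=> dST; pose c : {ffun V -> 'I_3} :=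
  [ffun v => if v \in S then 0 else if v \in T then 1 else ord_max].
rewrite -(sum_outputs (e, c, true)) !big_ord_recl big_ord0 addr0 !game_familyE /=.
rewrite addrA; congr (set_value e _ + set_value e _ + set_value e _);
  apply/setP => v; rewrite !inE ffunE.
- by case: ifP => // _; case: ifP.
- case: ifP => [vS|_]; last by case: ifP.
  by rewrite (disjointFr dST vS).
by case: ifP => //= _; case: ifP.
Qed.

(** The tripartitions given by (S, T) and by (S :|: T, set0) have the same third part, which
    cancels. *)
Lemma set_valueU e (S T : {set V}) : [disjoint S & T] ->
  set_value e (S :|: T) = set_value e S + set_value e T.
Proof.
move=> /(set_value_tripartition e) ST.
have := @set_value_tripartition e (S :|: T) set0.
rewrite -setI_eq0 setI0 eqxx set_value0 addr0 setU0 => /(_ isT).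
by rewrite -ST => /addIr.
Qed.

Lemma set_valueT e : set_value e setT = 1.
Proof.
have := @set_value_tripartition e setT set0.
by rewrite -setI_eq0 setI0 eqxx setU0 setCT !set_value0 !addr0 => ->.
Qed.

Lemma set_value_sum e (S : {set V}) :
  set_value e S = \sum_(v in S) set_value e [set v].
Proof.
have [n] := ubnP #|S|; elim: n S => // n IH S.
have [->|[v vS]] := set_0Vmem S; first by rewrite set_value0 big_set0.
rewrite (cardsD1 v) vS ltnS => /IH IHS.
rewrite (big_setD1 v) //= -IHS -set_valueU ?setD1K //.
by rewrite disjoints1 !inE eqxx.
Qed.

Lemma set_value_notin (e : hedge) v : v \notin val e -> set_value e [set v] = 0.
Proof.
move=> ve; apply: set_value_eq0; apply/setP => w; rewrite !inE.
by apply/negP => /andP[we /eqP wv]; rewrite wv (negPf ve) in we.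
Qed.

(** Independence of the edge: if e and f both contain v, the other vertices of either edge share
    that edge with v, so the mismatched outputs are exclusive. *)
Lemma set_value1 (e : hedge) v : v \in val e ->
  set_value e [set v] = vertex_family q v.
Proof.
move=> ve; have vf := some_edgeP v; set f := some_edge v in vf *.
rewrite /vertex_family -/f -/(set_value f [set v]).
have [-> //|ef] := eqVneq e f; apply: eq_game_family.
- by apply: contra_neq ef => -[].
- move=> b b1; rewrite edge_input_class1; apply/exclusive_setsP => u w.
  rewrite !inE /= ffunE !inE => /andP[_ /eqP ->] /andP[wf] wb.
  apply: (exclusive_in vf wf); apply: contraTneq wb => <-; rewrite eqxx.
  by rewrite eq_sym.
move=> a a1; rewrite edge_input_class1; apply/exclusive_setsP => u w.
rewrite !inE /= ffunE !inE => /andP[ue ua] /andP[_ /eqP ->].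
apply: (exclusive_in ue ve); apply: contraTneq ua => ->; rewrite eqxx.
by rewrite eq_sym.
Qed.

Lemma vertex_family_relations : @hypergraph_relations R H A (vertex_family q).
Proof.
split=> [v|e eH]; first by case: rel_q => proj _ _; apply: proj.
pose e' : hedge := exist _ e eH.
rewrite -(set_valueT e') set_value_sum [RHS](bigID (mem e)) /=.
rewrite [X in _ = _ + X]big1 ?addr0 => [|v /andP[_ ve]]; last first.
  exact: (@set_value_notin e').
by apply: eq_big => [v|v ve]; rewrite ?inE // (@set_value1 e').
Qed.

Lemma vertex_familyK : colour_family (vertex_family q) = q.
Proof.
apply/funext => -[x a]; rewrite game_familyE set_value_sum /colour_family /=.
rewrite [RHS](bigID (mem (val x.1.1))) /=.
rewrite [X in _ = _ + X]big1 ?addr0 => [|v /andP[_ vx]]; last first.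
  exact: set_value_notin.
apply: eq_big => [v|v]; rewrite !inE; first by rewrite andbC.
by move=> /andP[ve _]; rewrite set_value1.
Qed.

End GameRepresentation.

Lemma hypergraph_algebra_colour_game (A : cstarAlgType R) :
  is_hypergraph_algebra H A -> is_game_algebra colour_game A.
Proof.
move=> [p univ_p]; exists (colour_family p).
apply: (universal_cstar_transfer (F := colour_family) (G := vertex_family)) univ_p.
- exact: colour_family_relations.
- exact: vertex_family_relations.
- by move=> B p' _; apply: colour_familyK.
- exact: vertex_familyK.
- by move=> B C f p' y hom_f; rewrite /colour_family (star_hom_sum hom_f).
- by [].
Qed.

End GameOfHypergraph.

(** * From synchronous games to hypergraphs *)

Section HypergraphOfGame.
Variable G : nonlocal_game.
Hypothesis sync_G : synchronous G.
Notation IO := (input G * output G)%type.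

Definition forbidden (uw : IO * IO) : bool :=
  ~~ rule uw.1.1 uw.2.1 uw.1.2 uw.2.2.

(* The extra vertex attached to a forbidden pair [(u, w)] stands for
   [1 - p u - p w]. *)
Definition game_vertex : finType := (IO + {uw : IO * IO | forbidden uw})%type.

Definition input_edge (x : input G) : {set game_vertex} :=
  [set inl (x, a) | a : output G].

Definition forbidden_edge (r : {uw : IO * IO | forbidden uw}) :
    {set game_vertex} :=
  [set inl (val r).1; inl (val r).2; inr r].

Definition game_edges : {set {set game_vertex}} :=
  [set input_edge x | x : input G] :|: [set forbidden_edge r | r in predT].

Lemma game_vertex_covered v : exists2 e, e \in game_edges & v \in e.
Proof.
case: v => [[x a]|r].
  exists (input_edge x); first by rewrite inE imset_f.
  exact: (imset_f (fun a => inl (x, a))).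
exists (forbidden_edge r); first by rewrite inE orbC imset_f.
by rewrite !inE eqxx orbT.
Qed.

Definition game_hypergraph : hypergraph := Hypergraph game_vertex_covered.

(** Synchronicity enters here: a forbidden edge has three distinct vertices, so its sum counts both
    members of the pair. *)
Lemma forbidden_neq uw : forbidden uw -> uw.1 != uw.2.
Proof.
case: uw => [[x a] [y b]]; apply: contraNneq => -[-> ->].
by rewrite sync_G.
Qed.

Section Sums.
Variables (T : zmodType) (F : game_vertex -> T).

Lemma sum_input_edge x :
  \sum_(v in input_edge x) F v = \sum_a F (inl (x, a)).
Proof. by rewrite big_imset //= => a b _ _ []. Qed.

Lemma sum_forbidden_edge r :
  \sum_(v in forbidden_edge r) F v =
  F (inl (val r).1) + F (inl (val r).2) + F (inr r).
Proof.
rewrite /forbidden_edge -setUA big_setU1 /=; last first.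
  rewrite !inE orbF; apply/eqP => -[eq12].
  by have := forbidden_neq (valP r); rewrite eq12 eqxx.
by rewrite big_setU1 ?inE // big_set1 addrA.
Qed.

End Sums.

Variable R : realType.

Definition extend_family (A : cstarAlgType R) (q : IO -> A) (v : game_vertex) :
    A :=
  match v with
  | inl u => q u
  | inr r => 1 - (q (val r).1 + q (val r).2)
  end.

Definition restrict_family (A : cstarAlgType R) (p : game_vertex -> A) (u : IO) :
    A :=
  p (inl u).

Lemma extend_family_relations (A : cstarAlgType R) (q : IO -> A) :
  @game_relations R G A q ->
  @hypergraph_relations R game_hypergraph A (extend_family q).
Proof.
move=> [proj_q sum_q orth_q]; split=> [[[x a]|[[u w] /= uw]]|e].
- exact: proj_q.
- apply: projection_compl.
  have qP z : is_projection (q z) by case: z => x a; apply: proj_q.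
  have [[su qu] [sw qw]] := (qP u, qP w).
  have quw : q u * q w = 0.
    by case: u w uw {su qu sw qw} => [x a] [y b] /negbTE /= /orth_q.
  (* The rule need not be symmetric; the reverse product vanishes by taking adjoints. *)
  have qwu : q w * q u = 0 by rewrite -sw -su -starrM quw star0.
  split; first by rewrite starD su sw.
  by rewrite mulrDl !mulrDr qu qw quw qwu addr0 add0r.
case/setUP => /imsetP[x _ ->]; first by rewrite sum_input_edge /= sum_q.
by rewrite sum_forbidden_edge /= addrC subrK.
Qed.

Lemma restrict_family_relations (A : cstarAlgType R) (p : game_vertex -> A) :
  @hypergraph_relations R game_hypergraph A p ->
  @game_relations R G A (restrict_family p).
Proof.
move=> [proj_p sum_p]; split=> [x a|x|x y a b xyab]; first exact: proj_p.
  by rewrite -(sum_p (input_edge x)) ?sum_input_edge // inE imset_f.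
have xyP : forbidden ((x, a), (y, b)) by rewrite /forbidden xyab.
pose r : {uw | forbidden uw} := exist _ (x, a, (y, b)) xyP.
have re : forbidden_edge r \in game_edges by rewrite inE orbC imset_f.
apply: (projection_sum_orthogonal proj_p (sum_p _ re)).
- by rewrite !inE eqxx.
- by rewrite !inE eqxx orbT.
by apply: contraNneq (forbidden_neq xyP) => -[-> ->].
Qed.

(** The sum over a forbidden edge determines the value at its extra vertex. *)
Lemma restrict_familyK (A : cstarAlgType R) (p : game_vertex -> A) :
  @hypergraph_relations R game_hypergraph A p ->
  extend_family (restrict_family p) = p.
Proof.
move=> [_ sum_p]; apply/funext => -[//|r] /=.
rewrite -(sum_p (forbidden_edge r)) ?inE 1?orbC ?imset_f //.
by rewrite sum_forbidden_edge addrC addKr.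
Qed.

Lemma game_algebra_hypergraph (A : cstarAlgType R) :
  is_game_algebra G A -> is_hypergraph_algebra game_hypergraph A.
Proof.
move=> [q univ_q]; exists (extend_family q).
apply: (universal_cstar_transfer (F := extend_family) (G := restrict_family)) univ_q.
- exact: extend_family_relations.
- exact: restrict_family_relations.
- by [].
- exact: restrict_familyK.
- move=> B C f q' [u|r] hom_f //=.
  rewrite (star_homB hom_f) (star_homD hom_f).
  by case: hom_f => _ -> _ _.
- by [].
Qed.

End HypergraphOfGame.

Local Close Scope complex_scope.
Local Close Scope ring_scope.

Theorem theorem2p19 (R : realType) :
  [/\ (* every free hypergraph C*-algebra is a synchronous game C*-algebra *)
      forall H : hypergraph, exists2 G : nonlocal_game, synchronous G &
        forall A : cstarAlgType R, is_hypergraph_algebra H A ->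
        exists2 B : cstarAlgType R, is_game_algebra G B & cstar_isomorphic A B,
      (* every synchronous game C*-algebra is a free hypergraph C*-algebra *)
      forall G : nonlocal_game, synchronous G -> exists H : hypergraph,
        forall B : cstarAlgType R, is_game_algebra G B ->
        exists2 A : cstarAlgType R, is_hypergraph_algebra H A & cstar_isomorphic A B
      (* at most three outputs suffice *)
    & forall H : hypergraph,
      exists G : nonlocal_game, [/\ synchronous G, #|output G| <= 3 &
        forall A : cstarAlgType R, is_hypergraph_algebra H A ->
        exists2 B : cstarAlgType R, is_game_algebra G B & cstar_isomorphic A B]].
Proof.
split=> [H|G sync_G|H].
- exists (colour_game H); first exact: colour_game_synchronous.
  move=> A /hypergraph_algebra_colour_game GA.
  by exists A => //; apply: cstar_isomorphic_refl.
- exists (game_hypergraph G) => A /(game_algebra_hypergraph sync_G) HA.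
  by exists A => //; apply: cstar_isomorphic_refl.
exists (colour_game H); split; first exact: colour_game_synchronous.
  by rewrite card_ord.
move=> A /hypergraph_algebra_colour_game GA.
by exists A => //; apply: cstar_isomorphic_refl.
Qed.
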